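(* Let $G$ be a finite, connected, simple graph and let $I_G$ be its toric ideal. Then $I_G$ is subgraph splittable if and only if it is edge splittable.
   Context: Let $K$ be any field. Let $G$ be a finite, connected, undirected graph without loops or multiple edges, with vertices $v_1,\dots,v_n$ and edge set $E(G)=\{e_1,\dots,e_m\}$. The edges are also used as variables of the polynomial ring $K[e_1,\dots,e_m]$. The toric ideal $I_G\subset K[e_1,\dots,e_m]$ is the kernel of the $K$-algebra map $K[e_1,\dots,e_m]\to K[v_1,\dots,v_n]$ sending an edge $e=\{v_i,v_j\}$ to $v_iv_j$; equivalently it is generated by all binomials $\mathbf{x}^{\mathbf u}-\mathbf{x}^{\mathbf v}$ whose two monomials have the same image. For a subgraph $H$ of $G$ (not necessarily connected), $I_H$ is defined in the same way in the variables $E(H)$ and is regarded as the ideal it generates in $K[e_1,\dots,e_m]$; sums, inclusions and equalities of such ideals are taken in $K[e_1,\dots,e_m]$. For an even closed walk $w=(e_{i_1},e_{i_2},\dots,e_{i_{2q}})$ of $G$, put $B_w=\prod_{k=1}^q e_{i_{2k-1}}-\prod_{k=1}^q e_{i_{2k}}\in I_G$; $V(w)$ and $E(w)$ denote the sets of vertices and edges of $w$. A minimal system of binomial generators (minimal generating set) of $I_G$ is an inclusion-minimal generating set consisting of binomials; its elements have the form $B_w$, and it is written $S=\{B_{w_1},\dots,B_{w_r}\}$ with $w_i$ even closed walks. For an edge $e$ of $G$, $G\setminus e$ is the graph with the same vertex set as $G$ and edge set $E(G)\setminus\{e\}$. For $S=\{B_{w_1},\dots,B_{w_r}\}$ a minimal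 generating set of $I_G$ and $e\in E(G)$, $G_S^e$ is the subgraph of $G$ with vertex set $\bigcup_{i:\,e\in E(w_i)}V(w_i)$ and edge set $\bigcup_{i:\,e\in E(w_i)}E(w_i)$. A subgraph splitting of $I_G$ is an equality $I_G=I_{G_1}+I_{G_2}$ with $G_1,G_2$ subgraphs of $G$, $I_{G_1}\neq I_G$ and $I_{G_2}\neq I_G$. $I_G$ is subgraph splittable if it has a subgraph splitting. A subgraph splitting $I_G=I_{G_1}+I_{G_2}$ is an edge splitting if there exist an edge $e$ of $G$ and a minimal generating set $S$ of $I_G$ such that $\{G_1,G_2\}=\{G_S^e,\,G\setminus e\}$. $I_G$ is edge splittable if it has an edge splitting. *)

(* Defs.v *)
From mathcomp Require Import all_boot all_order all_algebra.
From mathcomp.multinomials Require Import mpoly.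

Set Implicit Arguments.
Unset Strict Implicit.
Unset Printing Implicit Defensive.

Import GRing.Theory.
Local Open Scope ring_scope.

(* A finite simple graph with vertices v_i (i : 'I_n) and edges e_j (j : 'I_m),
   an edge being labelled by its set of two endpoints. *)
Record sgraph (n m : nat) := SGraph {
  ends : 'I_m -> {set 'I_n};
  card_ends : forall e, #|ends e| = 2%N;
  ends_inj : injective ends
}.

Section Graphs.

Variables (n m : nat) (G : sgraph n m).

Definition adj : rel 'I_n := [rel x y | [exists e, ends G e == [set x; y]]].

Definition connected : Prop := (0 < n)%N /\ forall x y, connect adj x y.

(* A pair of a vertex set and an edge set. *)
Definition subgr : Type := ({set 'I_n} * {set 'I_m})%type.

Definition is_subgraph (H : subgr) : Prop :=
  forall e, e \in H.2 -> ends G e \subset H.1.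

Definition del_edge (e : 'I_m) : subgr := ([set: 'I_n], [set~ e]).

(* The edges of w form a walk from x to y. *)
Fixpoint is_walk (x : 'I_n) (w : seq 'I_m) (y : 'I_n) : bool :=
  if w is e :: w' then [exists z, (ends G e == [set x; z]) && is_walk z w' y]
  else x == y.

Definition even_closed_walk (w : seq 'I_m) : Prop :=
  [/\ (0 < size w)%N, ~~ odd (size w) & exists x, is_walk x w x].

(* On a closed walk every vertex is an endpoint of an edge of the walk and
   conversely. *)
Definition walk_vertices (w : seq 'I_m) : {set 'I_n} :=
  \bigcup_(e in w) ends G e.

Definition walk_edges (w : seq 'I_m) : {set 'I_m} := [set e in w].

(* The graph G_S^e, for S presented as {B_w | w in ws}. *)
Definition edge_subgraph (ws : seq (seq 'I_m)) (e : 'I_m) : subgr :=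
  (\bigcup_(w <- ws | e \in walk_edges w) walk_vertices w,
   \bigcup_(w <- ws | e \in walk_edges w) walk_edges w).

End Graphs.

Section Ideals.

Variable R : comNzRingType.
Implicit Types A I J : R -> Prop.

Definition ideal_gen A : R -> Prop := fun p =>
  exists s : seq (R * R),
    (forall ab, ab \in s -> A ab.2) /\ p = \sum_(ab <- s) ab.1 * ab.2.

Definition ideal_add I J : R -> Prop := fun p =>
  exists a b, [/\ I a, J b & p = a + b].

Definition ideal_eq I J : Prop := forall p, I p <-> J p.

Definition minimal_generators A I : Prop :=
  ideal_eq (ideal_gen A) I /\
  forall A', (forall p, A' p -> A p) -> ideal_eq (ideal_gen A') I ->
    forall p, A p -> A' p.

End Ideals.

Section Toric.

Variables (K : fieldType) (n m : nat) (G : sgraph n m).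

Definition edge_map (p : {mpoly K[m]}) : {mpoly K[n]} :=
  p \mPo [tuple \prod_(v in ends G e) 'X_v | e < m].

Definition toric_ideal (p : {mpoly K[m]}) : Prop := edge_map p = 0.

(* p lies in the subring K[E] of K[e_1, ..., e_m]. *)
Definition poly_in_vars (E : {set 'I_m}) (p : {mpoly K[m]}) : Prop :=
  forall u, u \in msupp p -> forall e, e \notin E -> u e = 0%N.

(* I_H, extended to K[e_1, ..., e_m] from the subring K[E(H)] on which it is
   the kernel of the edge map. *)
Definition toric_ideal_sub (H : subgr n m) : {mpoly K[m]} -> Prop :=
  ideal_gen (fun p => poly_in_vars H.2 p /\ edge_map p = 0).

(* Positions start at 0 here, so the even k are the odd positions in the usual
   numbering e_{i_1}, ..., e_{i_2q}. *)
Definition walk_binomial (w : seq 'I_m) : {mpoly K[m]} :=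
  \prod_(k < size w | ~~ odd k) 'X_(tnth (in_tuple w) k)
  - \prod_(k < size w | odd k) 'X_(tnth (in_tuple w) k).

(* The walks ws list without repetition a minimal generating set
   S = {B_w | w in ws} of I_G. *)
Definition minimal_generating_walks (ws : seq (seq 'I_m)) : Prop :=
  [/\ forall w, w \in ws -> even_closed_walk G w,
      uniq [seq walk_binomial w | w <- ws]
    & minimal_generators (fun p => p \in [seq walk_binomial w | w <- ws])
        toric_ideal].

Definition subgraph_splitting (G1 G2 : subgr n m) : Prop :=
  [/\ is_subgraph G G1, is_subgraph G G2,
      ideal_eq toric_ideal
        (ideal_add (toric_ideal_sub G1) (toric_ideal_sub G2)),
      ~ ideal_eq (toric_ideal_sub G1) toric_ideal
    & ~ ideal_eq (toric_ideal_sub G2) toric_ideal].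

Definition subgraph_splittable : Prop :=
  exists G1 G2, subgraph_splitting G1 G2.

Definition edge_splitting (G1 G2 : subgr n m) : Prop :=
  subgraph_splitting G1 G2 /\
  exists e ws, minimal_generating_walks ws /\
    ((G1 = edge_subgraph G ws e /\ G2 = del_edge n e) \/
     (G1 = del_edge n e /\ G2 = edge_subgraph G ws e)).

Definition edge_splittable : Prop :=
  exists G1 G2, edge_splitting G1 G2.

End Toric.

(* Main.v *)
Require Import Defs.
From mathcomp Require Import all_boot all_order all_algebra.
From mathcomp.multinomials Require Import mpoly.
From mathcomp Require Import zify.
From Stdlib Require Import Classical.

Set Implicit Arguments.
Unset Strict Implicit.
Unset Printing Implicit Defensive.

Import GRing.Theory.
Local Open Scope ring_scope.

(** Every edge splitting is a subgraph splitting, so the content is the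
    converse.  Let [I_G = I_G1 + I_G2] be a subgraph splitting.

    Suppose first that [I_G] has a minimal generating set S of binomials [B_w],
    each [w] lying in [G1] or in [G2].  Some [w] in S does not lie in [G2],
    otherwise [I_G2 = I_G]; let [e] be an edge of [w] outside [G2].  Every
    generator whose walk uses [e] then comes from [G1], so [G_S^e] has its edges
    in [G1] and [I_(G_S^e)], being contained in [I_G1], is not [I_G].  Each
    generator lies in [I_(G_S^e)] or in [I_(G \ e)] according to whether its
    walk uses [e], so the two ideals add up to [I_G].  Finally [B_w] is not in
    [I_(G \ e)] provided [e] divides exactly one of the two monomials of [B_w]:
    composing the edge map with [e := 0] kills [I_(G \ e)] but sends [B_w] to a
    monomial up to sign ([elementary_not_del_edge]).

    It remains to find S.  A toric ideal is spanned by the binomials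
    [X^u - X^v] whose exponents have the same vertex degrees
    ([toric_binomials]).  Such a pair [u], [v] contains a closed trail using
    edges of [u] and of [v] alternately, and one that visits no vertex twice
    at even times has length at most [2n] ([closed_trail_exists]).  Splitting
    off one trail after another writes [X^u - X^v] as a combination of
    binomials [B_w] with [w] of length at most [2n] ([binomial_elementary]); if
    the common factors of [X^u] and [X^v] are removed first, the two monomials
    of each [B_w] have disjoint supports.  There are finitely many such walks,
    so those in [G1] or in [G2] form a finite generating family of [I_G], from
    which a minimal one is extracted
    ([minimal_generating_subsequence]). *)

(** * Alternating closed trails *)

Section Trails.

Variables (n m : nat) (G : sgraph n m).
Implicit Types (u v : 'X_{1..m}) (w : seq 'I_m) (x y z : 'I_n) (e : 'I_m).

(** The exponent of the image of [X^u] under the edge map: the degree of every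
    vertex in the multigraph with edge multiplicities [u]. *)
Definition vdeg u : 'X_{1..n} :=
  [multinom \sum_(e | x \in ends G e) u e | x < n].

Lemma vdegE u x : vdeg u x = (\sum_(e | x \in ends G e) u e)%N.
Proof. by rewrite mnmE. Qed.

Lemma vdegD u v : vdeg (u + v)%MM = (vdeg u + vdeg v)%MM.
Proof.
apply/mnmP=> x; rewrite mnmDE !vdegE -big_split /=.
by apply: eq_bigr => e _; rewrite mnmDE.
Qed.

Lemma vdegU e x : vdeg U_(e)%MM x = (x \in ends G e).
Proof.
rewrite vdegE; under eq_bigr do rewrite mnm1E.
case: (boolP (x \in ends G e)) => He.
  rewrite (bigD1 e) //= eqxx big1 // => f /andP[_ /negPf].
  by rewrite eq_sym => ->.
by rewrite big1 // => f Hf; case: eqP => // E; rewrite E Hf in He.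
Qed.

Lemma leq_vdeg u v x : (forall e, u e <= v e)%N -> (vdeg u x <= vdeg v x)%N.
Proof. by move=> le_uv; rewrite !vdegE; apply: leq_sum => e _. Qed.

Lemma vdeg_lt_edge u v x : (vdeg u x < vdeg v x)%N ->
  exists2 e, x \in ends G e & (u e < v e)%N.
Proof.
rewrite !vdegE => lt_uv.
have [/existsP[e /andP[]]|none] :=
  boolP [exists e, (x \in ends G e) && (u e < v e)%N]; first by exists e.
move: lt_uv; rewrite ltnNge leq_sum // => e ex; rewrite leqNgt.
by apply: contra none => lt_e; apply/existsP; exists e; rewrite ex.
Qed.

Lemma vdeg_eq0 u : vdeg u = 0%MM -> u = 0%MM.
Proof.
move=> u0; apply/mnmP=> e; rewrite mnm0E; apply/eqP.
have /card_gt0P[x xe] : (0 < #|ends G e|)%N by rewrite card_ends.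
move/mnmP/(_ x)/eqP: u0; rewrite vdegE mnm0E sum_nat_eq0.
by move=> /forallP/(_ e)/implyP/(_ xe).
Qed.

Lemma ends_other x e : x \in ends G e -> exists z, ends G e = [set x; z].
Proof.
have /eqP/cards2P[a [b [_ ->]]] := card_ends G e.
by rewrite !inE => /orP[]/eqP->; [exists b|exists a; rewrite setUC].
Qed.

(** The two endpoints are distinct, so the two indicators never add up to 2. *)
Lemma in_ends x z t e : ends G e = [set x; z] ->
  (t \in ends G e) = ((t == x) + (t == z) :> nat)%N :> nat.
Proof.
move=> E; have := card_ends G e; rewrite E cards2 !inE.
case: eqVneq => // xz _; do 2!case: eqVneq => // ?; subst.
by rewrite eqxx in xz.
Qed.

(** The exponents of the two monomials of [B_w].  Removing the first edge
    exchanges odd and even positions, hence the swap. *)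
Fixpoint parts w : 'X_{1..m} * 'X_{1..m} :=
  if w is e :: w' then ((U_(e) + (parts w').2)%MM, (parts w').1)
  else (0%MM, 0%MM).

Lemma parts_count w e : ((parts w).1 e + (parts w).2 e)%N = count_mem e w.
Proof.
elim: w => [|f w IH] /=; first by rewrite mnm0E.
by rewrite mnmDE mnm1E -IH -addnA [X in (_ + X)%N]addnC.
Qed.

Lemma parts_prefix w1 w2 e :
  ((parts w1).1 e <= (parts (w1 ++ w2)).1 e)%N /\
  ((parts w1).2 e <= (parts (w1 ++ w2)).2 e)%N.
Proof.
elim: w1 => [|f w1 [IH1 IH2]] /=; first by rewrite !mnm0E.
by rewrite !mnmDE leq_add2l.
Qed.

(** Along a walk, each visit to an interior vertex uses one edge at an odd
    position and one at an even position, so the two degrees can differ only at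
    the two ends.  This is what lets a trail be prolonged, and what puts the
    binomial of a closed walk in the toric ideal. *)
Lemma walk_balance x w y t : is_walk G x w y ->
  if odd (size w)
  then vdeg (parts w).1 t = (vdeg (parts w).2 t + (t == x) + (t == y))%N
  else (vdeg (parts w).1 t + (t == y))%N = (vdeg (parts w).2 t + (t == x))%N.
Proof.
elim: w x => [|e w IH] x /=; first by move/eqP->.
case/existsP=> z /andP[/eqP E /IH].
rewrite vdegD mnmDE vdegU (in_ends t E).
move: (nat_of_bool (t == x)) (nat_of_bool (t == y)) (nat_of_bool (t == z)).
move=> dx dy dz.
by case: odd => /=; lia.
Qed.

Lemma closed_walk_vdeg w :
  even_closed_walk G w -> vdeg (parts w).1 = vdeg (parts w).2.
Proof.
case=> _ /negPf ev [x /walk_balance bal]; apply/mnmP=> t.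
by have := bal t; rewrite ev => /addIn.
Qed.

Section Alternating.

Variables u v : 'X_{1..m}.
Hypothesis uv : vdeg u = vdeg v.

(** Edges may be repeated, but no more often than [u] (at odd positions) and
    [v] (at even positions) allow: this makes the two monomials of [B_w] divide
    [X^u] and [X^v]. *)
Definition closed_trail k w :=
  [/\ even_closed_walk G w, (size w <= k)%N, (forall e, (parts w).1 e <= u e)%N
    & (forall e, (parts w).2 e <= v e)%N].

(** A partial trail from [x] to [y], grown at its front, whose vertices at even
    times [x :: xs] are distinct.  The last clause remembers an even prefix from
    [x] to each of them, to be closed up as soon as a vertex recurs; the strict
    inequality says that [x] still has an unused edge of [v]. *)
Definition open_trail (xs : seq 'I_n) w := exists x y,
  [/\ [/\ uniq (x :: xs), size w = (size xs).*2, is_walk G x w y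
        & y \in x :: xs],
      [/\ (forall e, (parts w).1 e <= u e)%N, (forall e, (parts w).2 e <= v e)%N
        & (vdeg (parts w).2 x < vdeg v x)%N]
    & forall z, z \in x :: xs ->
      exists w1 w2, [/\ w = w1 ++ w2, ~~ odd (size w1) & is_walk G x w1 z]].

(** Prepend an unused edge [e2] of [v] at [x], leading to [z]; then [z] has
    received at least one more edge of [v] than of [u], so an unused edge [e1]
    of [u] leads on to some [t].  If [t] is new the trail has grown; otherwise the
    part between its two visits is an even closed trail, of length at most
    [2n] because the vertices visited are distinct. *)
Lemma open_trail_extend xs w : open_trail xs w ->
  (exists w', closed_trail n.*2 w') \/
  (exists xs' w', size xs' = (size xs).+1 /\ open_trail xs' w').
Proof.
case=> x [y [[xs_uniq sz_w wP y_xs] [le_u le_v lt_x] prefixes]].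
have ev_w : odd (size w) = false by rewrite sz_w odd_double.
have [e2 xe2 lt_e2] := vdeg_lt_edge lt_x.
have [z E2] := ends_other xe2.
have le_v2 e : ((U_(e2) + (parts w).2)%MM e <= v e)%N.
  rewrite mnmDE mnm1E; case: eqP => [<-|_] //; exact: le_v.
have [e1 ze1 lt_e1] : exists2 e, z \in ends G e & ((parts w).1 e < u e)%N.
  apply: vdeg_lt_edge; rewrite uv.
  apply: leq_trans (leq_vdeg z le_v2); rewrite vdegD mnmDE vdegU (in_ends z E2).
  have := walk_balance z wP; rewrite ev_w eqxx /=.
  by move: (nat_of_bool (z == x)) (nat_of_bool (z == y)) => dx dy; lia.
have [t E1] := ends_other ze1.
have le_u1 e : ((U_(e1) + (parts w).1)%MM e <= u e)%N.
  rewrite mnmDE mnm1E; case: eqP => [<-|_] //; exact: le_u.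
have w'P z' w1 : is_walk G x w1 z' -> is_walk G t (e1 :: e2 :: w1) z'.
  move=> w1P /=; apply/existsP; exists z; rewrite E1 setUC eqxx /=.
  by apply/existsP; exists x; rewrite E2 setUC eqxx.
have [t_xs|t_xs] := boolP (t \in x :: xs).
  left; have [w1 [w2 [w_cat ev1 w1P]]] := prefixes _ t_xs.
  exists (e1 :: e2 :: w1); split.
  - by split=> //=; [rewrite negbK | exists t; apply: w'P].
  - have := max_card (mem (x :: xs)); rewrite card_ord (card_uniqP xs_uniq) /=.
    by have := size_cat w1 w2; rewrite -w_cat sz_w /=; lia.
  - move=> e; apply: leq_trans (le_u1 e); rewrite /= !mnmDE leq_add2l w_cat.
    by case: (parts_prefix w1 w2 e).
  - move=> e; apply: leq_trans (le_v2 e); rewrite /= !mnmDE leq_add2l w_cat.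
    by case: (parts_prefix w1 w2 e).
right; exists (x :: xs), (e1 :: e2 :: w); split=> //.
exists t, y; split.
- split=> //=; [by rewrite t_xs | by rewrite sz_w | exact: w'P | ].
  by rewrite inE y_xs orbT.
- split=> //; rewrite -uv; apply: leq_trans (leq_vdeg t le_u1).
  have := walk_balance t (w'P _ _ wP); rewrite /= ev_w /= eqxx.
  have /negPf-> : t != y by apply: contraNneq t_xs => ->.
  by lia.
- move=> z'; rewrite inE => /predU1P[->|/prefixes[w1 [w2 [-> ev1 w1P]]]].
    by exists [::], (e1 :: e2 :: w); split=> /=.
  by exists (e1 :: e2 :: w1), w2; split=> //=; [rewrite negbK | apply: w'P].
Qed.

(** A trail cannot keep growing: it would visit more than [n] distinct
    vertices at even times. *)
Lemma closed_trail_exists : u != 0%MM -> exists w, closed_trail n.*2 w.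
Proof.
move=> u_neq0.
have [x lt_x] : exists x, (0 < vdeg v x)%N.
  apply/existsP; apply: contraNT u_neq0 => /existsPn v0.
  apply/eqP/vdeg_eq0; rewrite uv; apply/mnmP=> x.
  by have := v0 x; rewrite -eqn0Ngt mnm0E => /eqP.
have search k : (exists w, closed_trail n.*2 w) \/
    (exists xs w, size xs = k /\ open_trail xs w).
  elim: k => [|k [|[xs [w [<- /open_trail_extend]]]]]; [right|by left|by []].
  exists [::], [::]; split=> //; exists x, x; split.
  - by split; rewrite //= ?mem_head.
  - split=> [e|e|]; rewrite ?mnm0E //.
    by rewrite vdegE big1 // => e _; rewrite mnm0E.
  - by move=> z; rewrite inE => /eqP->; exists [::], [::]; split=> /=.
have [//|[xs [w [sz_xs [t [y [[t_uniq _ _ _] _ _]]]]]]] := search n.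
have := max_card (mem (t :: xs)).
by rewrite card_ord (card_uniqP t_uniq) /= sz_xs ltnn.
Qed.

End Alternating.
End Trails.

(** * Ideals and minimal generating families *)

Section Ideals.

Variable R : comNzRingType.
Implicit Types (A B I J : R -> Prop) (p q : R).

Definition is_ideal J :=
  [/\ J 0, forall p q, J p -> J q -> J (p + q) & forall p q, J q -> J (p * q)].

Lemma is_ideal_gen A : is_ideal (ideal_gen A).
Proof.
split.
- by exists [::]; rewrite big_nil.
- move=> p q [s [As ->]] [t [At ->]]; exists (s ++ t); rewrite big_cat.
  by split=> // ab; rewrite mem_cat => /orP[/As|/At].
- move=> p q [s [As ->]]; exists [seq (p * ab.1, ab.2) | ab <- s]; split.
    by move=> ab /mapP[cd /As Acd ->].
  by rewrite big_map mulr_sumr; apply: eq_bigr => ab _; rewrite mulrA.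
Qed.

Lemma mem_ideal_gen A p : A p -> ideal_gen A p.
Proof.
move=> Ap; exists [:: (1, p)]; rewrite big_seq1 mul1r.
by split=> // ab; rewrite inE => /eqP->.
Qed.

Lemma ideal_gen_sub A J :
  is_ideal J -> (forall p, A p -> J p) -> forall p, ideal_gen A p -> J p.
Proof.
move=> [J0 JD JM] AJ p [s [As ->]]; rewrite big_seq.
by apply: (big_ind J) => // ab /As/AJ; apply: JM.
Qed.

Lemma ideal_gen_mono A B :
  (forall p, A p -> B p) -> forall p, ideal_gen A p -> ideal_gen B p.
Proof.
by move=> AB; apply: ideal_gen_sub (is_ideal_gen B) _ => p /AB/mem_ideal_gen.
Qed.

Lemma is_ideal_sum J (T : eqType) (r : seq T) (F : T -> R) :
  is_ideal J -> (forall i, i \in r -> J (F i)) -> J (\sum_(i <- r) F i).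
Proof. by case=> J0 JD _ JF; rewrite big_seq; apply: (big_ind J). Qed.

Lemma is_ideal_add I J : is_ideal I -> is_ideal J -> is_ideal (ideal_add I J).
Proof.
move=> [I0 ID IM] [J0 JD JM]; split.
- by exists 0, 0; rewrite addr0.
- move=> _ _ [a [b [Ia Jb ->]]] [c [d [Ic Jd ->]]].
  by exists (a + c), (b + d); rewrite addrACA; split; [apply: ID | apply: JD | ].
- move=> p _ [a [b [Ia Jb ->]]]; exists (p * a), (p * b).
  by rewrite mulrDr; split; [apply: IM | apply: JM | ].
Qed.

Lemma is_ideal_kernel (S : comNzRingType) (phi : {rmorphism R -> S}) :
  is_ideal (fun p => phi p = 0).
Proof.
split; first exact: rmorph0.
  by move=> p q p0 q0; rewrite rmorphD p0 q0 addr0.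
by move=> p q q0; rewrite rmorphM q0 mulr0.
Qed.

End Ideals.

Section Minimal.

Variables (R : comNzRingType) (T : eqType) (f : T -> R) (I : R -> Prop).

Definition generates (s : seq T) :=
  ideal_eq (ideal_gen (fun p => p \in [seq f i | i <- s])) I.

(** A generating subsequence of least length does it: dropping repeated values,
    or all the indices of a superfluous value, would give a shorter one. *)
Lemma minimal_generating_subsequence (s : seq T) : generates s ->
  exists s', [/\ {subset s' <= s}, uniq [seq f i | i <- s']
    & minimal_generators (fun p => p \in [seq f i | i <- s']) I].
Proof.
have [k] := ubnP (size s); elim: k s => // k IH s lt_k gen_s.
have [[s' [sub lt_s' gen_s']]|min_s] := classic (exists s',
    [/\ {subset s' <= s}, (size s' < size s)%N & generates s']).
  have [|s'' [sub' u_s'' min_s'']] := IH s' _ gen_s'.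
    exact: leq_trans lt_s' lt_k.
  by exists s''; split=> // i /sub'/sub.
exists s; split=> //.
  apply/negPn/negP => not_uniq; apply: min_s.
  have /subseqP[b _ undup_b] := undup_subseq [seq f i | i <- s].
  exists (mask b s); split.
  - by move=> i; apply: mem_mask.
  - rewrite -(size_map f (mask b s)) map_mask -undup_b -(size_map f s).
    by rewrite ltn_size_undup.
  - move=> p; rewrite -gen_s map_mask -undup_b.
    by split; apply: ideal_gen_mono => q; rewrite mem_undup.
split=> // A AS gen_A p p_s; apply: NNPP => not_Ap; apply: min_s.
exists [seq i <- s | f i != p]; split.
- by move=> i; rewrite mem_filter => /andP[].
- rewrite size_filter ltn_neqAle count_size andbT -all_count.
  have /mapP[i i_s p_i] := p_s.
  by apply/negP => /allP/(_ i i_s); rewrite p_i eqxx.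
- move=> q; rewrite -gen_s; split.
    apply: ideal_gen_mono => _ /mapP[i + ->].
    by rewrite mem_filter => /andP[_ /(map_f f)].
  rewrite gen_s -gen_A; apply: ideal_gen_mono => g Ag.
  have /mapP[i i_s g_i] := AS g Ag.
  apply/mapP; exists i => //; rewrite mem_filter i_s andbT -g_i.
  by apply: contra_notN not_Ap => /eqP<-.
Qed.

End Minimal.

(** * Toric ideals are generated by short walks *)

Section Toric.

Variables (K : fieldType) (n m : nat) (G : sgraph n m).
Implicit Types (u v : 'X_{1..m}) (w : seq 'I_m) (e : 'I_m) (E : {set 'I_m}).
Implicit Types p : {mpoly K[m]}.

Lemma walk_binomialE w :
  walk_binomial K w = 'X_[(parts w).1] - 'X_[(parts w).2].
Proof.
suff [e o] : \prod_(k < size w | ~~ odd k) 'X_(tnth (in_tuple w) k)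
             = 'X_[(parts w).1] :> {mpoly K[m]}
     /\ \prod_(k < size w | odd k) 'X_(tnth (in_tuple w) k)
             = 'X_[(parts w).2] :> {mpoly K[m]}.
  by rewrite /walk_binomial e o.
elim: w => [|f w [IHe IHo]]; first by rewrite !big_ord0 mpolyX0.
have shift (k : 'I_(size w)) :
    tnth (in_tuple (f :: w)) (lift ord0 k) = tnth (in_tuple w) k.
  by rewrite !(tnth_nth f).
split; rewrite big_mkcond big_ord_recl /=.
  rewrite mpolyXD -IHo [X in _ = _ * X]big_mkcond; congr (_ * _).
  by apply: eq_bigr => k _; rewrite shift /= negbK.
rewrite mul1r -IHe [RHS]big_mkcond.
by apply: eq_bigr => k _; rewrite shift.
Qed.

(** The edge map composed with setting to zero the variables outside [E]. *)
Definition restricted_map E p : {mpoly K[n]} :=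
  p \mPo [tuple if e \in E then \prod_(x in ends G e) 'X_x else 0 | e < m].

Lemma restricted_mapX E u :
  restricted_map E 'X_[u] =
  if [forall (e | e \notin E), u e == 0%N] then 'X_[vdeg G u] else 0.
Proof.
rewrite /restricted_map comp_mpolyX.
case: ifPn => [/forallP uE|/forallPn[e]]; last first.
  rewrite negb_imply => /andP[/negPf eE ue].
  by rewrite (bigD1 e) //= tnth_mktuple eE expr0n (negPf ue) mul0r.
transitivity (\prod_(e < m) \prod_(x in ends G e) ('X_x ^+ u e : {mpoly K[n]})).
  apply: eq_bigr => e _; rewrite tnth_mktuple prodrXl.
  case: ifPn => // /(implyP (uE e))/eqP->; by rewrite !expr0.
rewrite mpolyXE_id (exchange_big_dep xpredT) //=.
by apply: eq_bigr => x _; rewrite vdegE prodrXr.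
Qed.

Lemma restricted_map_in_vars E p :
  poly_in_vars E p -> restricted_map E p = edge_map G p.
Proof.
move=> pE; rewrite /restricted_map /edge_map !comp_mpolyEX.
apply: eq_big_seq => u u_p; rewrite !comp_mpolyX.
congr (_ *: _); apply: eq_bigr => e _; rewrite !tnth_mktuple.
by case: ifPn => // /(pE u u_p)->; rewrite !expr0.
Qed.

Lemma edge_mapX u : edge_map G 'X_[u] = 'X_[vdeg G u] :> {mpoly K[n]}.
Proof.
rewrite -(@restricted_map_in_vars [set: 'I_m]) ?restricted_mapX.
  by rewrite ifT //; apply/forallP => e; rewrite inE.
by move=> ? _ e; rewrite inE.
Qed.

Lemma is_ideal_toric : is_ideal (toric_ideal (K := K) G).
Proof. 
exact: is_ideal_kernel
  (comp_mpoly [tuple \prod_(x in ends G e) 'X_x | e < m]).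
Qed.

Lemma is_ideal_toric_sub (H : subgr n m) :
  is_ideal (toric_ideal_sub (K := K) G H).
Proof. exact: is_ideal_gen. Qed.

Lemma toric_ideal_subW (H : subgr n m) p :
  toric_ideal_sub G H p -> toric_ideal G p.
Proof. by apply: ideal_gen_sub is_ideal_toric _ p => p []. Qed.

Lemma walk_binomial_toric w :
  even_closed_walk G w -> toric_ideal G (walk_binomial K w).
Proof.
move=> /closed_walk_vdeg ww; rewrite /toric_ideal walk_binomialE.
rewrite /edge_map comp_mpolyB.
by rewrite -!/(edge_map G _) !edge_mapX ww subrr.
Qed.

Lemma walk_binomial_in_vars E w :
  {subset w <= E} -> poly_in_vars E (walk_binomial K w).
Proof.
move=> wE u u_w e eE.
have : u \in [:: (parts w).1; (parts w).2].
  apply: contraLR u_w; rewrite !inE negb_or mcoeff_msupp negbK => /andP[u1 u2].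
  rewrite walk_binomialE mcoeffB !mcoeffX ![_ == u]eq_sym.
  by rewrite (negPf u1) (negPf u2) subrr.
have : ((parts w).1 e + (parts w).2 e)%N = 0%N.
  by rewrite parts_count; apply/count_memPn; apply: contra eE => /wE.
by move/eqP; rewrite addn_eq0 !inE => /andP[/eqP? /eqP?] /orP[]/eqP->.
Qed.

(** The length bound leaves finitely many walks; the disjointness of the two
    monomials makes every edge of [w] visible in [B_w]. *)
Definition elementary_walk w :=
  [/\ even_closed_walk G w, (size w <= n.*2)%N
    & forall e, (parts w).1 e = 0%N \/ (parts w).2 e = 0%N].

(** Induction on the degree of [X^u].  A common variable of [X^u] and [X^v] is
    factored out; when there is none, a closed trail [w] with monomials
    [X^u1 | X^u] and [X^v1 | X^v] gives
    [X^u - X^v = X^(u - u1) * B_w + X^v1 * (X^(u - u1) - X^(v - v1))], and the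
    last difference again has equal vertex degrees. *)
Lemma binomial_elementary (J : {mpoly K[m]} -> Prop) E u v :
    is_ideal J ->
    (forall w, elementary_walk w -> {subset w <= E} -> J (walk_binomial K w)) ->
    (forall e, e \notin E -> u e = 0%N) -> (forall e, e \notin E -> v e = 0%N) ->
  vdeg G u = vdeg G v -> J ('X_[u] - 'X_[v]).
Proof.
move=> [J0 JD JM] JW.
have [k] := ubnP (mdeg u); elim: k u v => // k IH u v lt_k uE vE uv.
have [u0|u_neq0] := eqVneq u 0%MM.
  have -> : v = 0%MM.
    apply: (@vdeg_eq0 _ _ G); rewrite -uv u0; apply/mnmP=> x.
    by rewrite vdegE big1 ?mnm0E // => e _; rewrite mnm0E.
  by rewrite u0 subrr.
have cancel_part u1 v1 : u1 != 0%MM -> (forall e, u1 e <= u e)%N ->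
    (forall e, v1 e <= v e)%N -> vdeg G u1 = vdeg G v1 ->
  J ('X_[u - u1] - 'X_[v - v1]).
  move=> nz_u1 le_u /[dup] le_v /mnm_lepP le_v1 uv1.
  have le_u1 : (u1 <= u)%MM by apply/mnm_lepP.
  apply: IH.
  - have := congr1 (@mdeg _) (submK le_u1); rewrite mdegD -ltnS.
    by move: nz_u1 lt_k; rewrite -mdeg_eq0; lia.
  - by move=> e /uE; rewrite mnmBE => ->.
  - by move=> e /vE; rewrite mnmBE => ->.
  - apply: (@addIm _ (vdeg G u1)).
    by rewrite {2}uv1 -!vdegD !submK.
have [/existsP[e /andP[ue ve]]|disj] :=
    boolP [exists e, (0 < u e) && (0 < v e)]%N.
  have le_e (t : 'X_{1..m}) : (0 < t e)%N -> (U_(e) <= t)%MM.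
    by move=> te; apply/mnm_lepP => f; rewrite mnm1E; case: eqP => // <-.
  rewrite -(submK (le_e _ ue)) -(submK (le_e _ ve)) !mpolyXD -mulrBl mulrC.
  apply: JM; apply: cancel_part => //; try exact/mnm_lepP/le_e.
  by rewrite -mdeg_eq0 mdeg1.
have [w [ww sz_w le_u le_v]] := closed_trail_exists uv u_neq0.
have wE : {subset w <= E}.
  move=> e; rewrite -has_pred1 has_count -parts_count; apply: contraLR.
  move=> eE; have := le_u e; have := le_v e.
  by rewrite (uE e eE) (vE e eE) !leqn0 => /eqP-> /eqP->.
have Bw : J (walk_binomial K w).
  apply: JW => //; split=> // e.
  have := le_u e; have := le_v e; move/existsPn/(_ e): disj.
  by rewrite negb_and -!eqn0Ngt => /orP[]/eqP-> => [_|]; rewrite leqn0 => /eqP;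
    [left|right].
have w_neq0 : (parts w).1 != 0%MM.
  apply/eqP => w0; have := closed_walk_vdeg ww; rewrite w0 => /esym.
  have -> : vdeg G 0%MM = 0%MM.
    by apply/mnmP=> x; rewrite vdegE big1 ?mnm0E // => e _; rewrite mnm0E.
  move/vdeg_eq0 => w0'; case: ww => + _ _.
  case: (w) w0 w0' => //= e w' /mnmP/(_ e).
  by rewrite mnmDE mnm1E eqxx mnm0E.
have := cancel_part _ _ w_neq0 le_u le_v (closed_walk_vdeg ww).
move/mnm_lepP: le_u => le_u; move/mnm_lepP: le_v => le_v.
move/(JM 'X_[(parts w).2]) => Jrest.
have := JD _ _ (JM 'X_[u - (parts w).1] _ Bw) Jrest.
rewrite walk_binomialE !mulrBr -!mpolyXD submK // [((parts w).2 + _)%MM]addmC.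
by rewrite [((parts w).2 + _)%MM]addmC submK // addrA subrK.
Qed.

(** Replace every monomial of [p] by a fixed monomial of [p] with the same image
    under the edge map.  The errors are binomials with equal images, and what
    remains is zero, because its coefficients are those of [edge_map G p]. *)
Lemma toric_binomials (J : {mpoly K[m]} -> Prop) p :
    is_ideal J ->
    (forall u v, u \in msupp p -> v \in msupp p -> vdeg G u = vdeg G v ->
      J ('X_[u] - 'X_[v])) ->
  toric_ideal G p -> J p.
Proof.
move=> idJ Jbin p0; have [J0 JD JM] := idJ.
pose rep d := nth 0%MM (msupp p) (find (fun u => vdeg G u == d) (msupp p)).
have repP u : u \in msupp p ->
    rep (vdeg G u) \in msupp p /\ vdeg G (rep (vdeg G u)) = vdeg G u.
  move=> u_p; have has_u : has (fun v => vdeg G v == vdeg G u) (msupp p).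
    by apply/hasP; exists u.
  by split; [rewrite mem_nth // -has_find | apply/eqP/(nth_find 0%MM has_u)].
have rep0 : \sum_(u <- msupp p) p@_u *: 'X_[rep (vdeg G u)] = 0.
  pose D := undup [seq vdeg G u | u <- msupp p].
  transitivity (\sum_(d <- D) (edge_map G p)@_d *: 'X_[rep d]); last first.
    by rewrite p0 big1 // => d _; rewrite mcoeff0 scale0r.
  transitivity (\sum_(d <- D) \sum_(u <- msupp p)
      (p@_u * (vdeg G u == d)%:R) *: ('X_[rep d] : {mpoly K[m]})).
    rewrite exchange_big /=; apply: eq_big_seq => u u_p.
    rewrite (bigD1_seq (vdeg G u)) ?undup_uniq ?mem_undup ?map_f //=.
    rewrite eqxx mulr1 big1 ?addr0 // => d; rewrite eq_sym => /negPf->.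
    by rewrite mulr0 scale0r.
  apply: eq_bigr => d _; rewrite -scaler_suml; congr (_ *: _).
  rewrite /edge_map comp_mpolyEX raddf_sum; apply: eq_bigr => u _.
  by rewrite /= -/(edge_map G _) edge_mapX mcoeffZ mcoeffX.
have -> : p = \sum_(u <- msupp p) p@_u *: ('X_[u] - 'X_[rep (vdeg G u)]).
  under eq_bigr do rewrite scalerBr.
  by rewrite sumrB rep0 subr0 -mpolyE.
apply: is_ideal_sum => // u u_p; rewrite -mul_mpolyC; apply: JM.
by have [? ?] := repP u u_p; apply: Jbin.
Qed.

Lemma toric_ideal_sub_elementary (J : {mpoly K[m]} -> Prop) (H : subgr n m) :
    is_ideal J ->
    (forall w, elementary_walk w -> {subset w <= H.2} -> J (walk_binomial K w)) ->
  forall p, toric_ideal_sub G H p -> J p.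
Proof.
move=> idJ JW; apply: ideal_gen_sub => // p [pE p0].
apply: toric_binomials p0 => // u v u_p v_p.
by apply: (binomial_elementary idJ JW) => e eE; [apply: (pE u)|apply: (pE v)].
Qed.

Lemma restricted_map_toric_sub (H : subgr n m) E p :
  [disjoint E & H.2] -> toric_ideal_sub G H p -> restricted_map (~: E) p = 0.
Proof.
move=> dis; apply: (ideal_gen_sub (is_ideal_kernel (comp_mpoly _))).
move=> q [qE q0]; rewrite -[LHS]/(restricted_map _ q) restricted_map_in_vars //.
move=> u u_q e; rewrite inE negbK => eE; apply: (qE u u_q).
by apply: contraL eE => eH; rewrite (disjointFl dis eH).
Qed.

(** Setting [e := 0] before the edge map kills [I_(G \ e)], but keeps exactly
    one of the two monomials of [B_w]. *)
Lemma elementary_not_del_edge w e :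
  elementary_walk w -> e \in w ->
  ~ toric_ideal_sub G (del_edge n e) (walk_binomial K w).
Proof.
case=> ww _ disj ew /(@restricted_map_toric_sub _ [set e]).
have -> : [disjoint [set e] & (del_edge n e).2].
  by rewrite disjoints1 !inE eqxx.
move/(_ isT)/eqP.
rewrite walk_binomialE /restricted_map comp_mpolyB -!/(restricted_map _ _).
have supp u : [forall (f | f \notin ~: [set e]), u f == 0%N] = (u e == 0%N).
  apply/forallP/idP => [/(_ e)|ue f]; rewrite !inE negbK ?eqxx //.
  by apply/implyP => /eqP->.
rewrite !restricted_mapX !supp.
move: ew; rewrite -has_pred1 has_count -parts_count.
have X0 (d : 'X_{1..n}) : ('X_[d] == 0 :> {mpoly K[n]}) = false.
  by apply/eqP => /(congr1 (mcoeff d))/eqP; rewrite mcoeffX eqxx mcoeff0 oner_eq0.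
case: (disj e) => ->; rewrite ?addn0 ?add0n lt0n => /negPf->.
  by rewrite eqxx subr0 X0.
by rewrite eqxx sub0r oppr_eq0 X0.
Qed.

End Toric.

(** * From a subgraph splitting to an edge splitting *)

Lemma filter_prop (T : eqType) (P : T -> Prop) (s : seq T) :
  exists s' : seq T, forall i, i \in s' <-> i \in s /\ P i.
Proof.
elim: s => [|i s [s' IH]]; first by exists [::] => i; split=> // -[].
have [Pi|nPi] := classic (P i).
  exists (i :: s') => j; rewrite !inE; split.
    by case/predU1P=> [->|/IH[-> ?]]; rewrite ?eqxx ?orbT.
  by case=> /predU1P[->|js] Pj; rewrite ?eqxx //; apply/orP; right; apply/IH.
exists s' => j; rewrite inE; split; first by case/IH=> ->; rewrite orbT.
by case=> /predU1P[->//|js] Pj; apply/IH.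
Qed.

Lemma short_words (T : finType) k :
  exists s : seq (seq T), forall w, (size w <= k)%N -> w \in s.
Proof.
exists (flatten [seq [seq val t | t <- enum {: j.-tuple T}] | j <- iota 0 k.+1]).
move=> w le_k; apply/flatten_mapP; exists (size w); first by rewrite mem_iota.
by apply/mapP; exists (in_tuple w); rewrite ?mem_enum.
Qed.

Lemma bigcup_seqP (I : eqType) (T : finType) (r : seq I) (P : pred I)
    (F : I -> {set T}) x :
  reflect (exists i, [/\ i \in r, P i & x \in F i])
    (x \in \bigcup_(i <- r | P i) F i).
Proof.
elim: r => [|i r IH]; first by rewrite big_nil inE; right=> -[i []].
rewrite big_cons; have [Pi|nPi] := boolP (P i); last first.
  apply: (iffP IH) => -[j [jr Pj xj]]; exists j; split=> //.
    by rewrite inE jr orbT.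
  by move: jr; rewrite inE => /predU1P[ji|//]; rewrite -ji Pj in nPi.
rewrite inE; apply: (iffP orP) => [[xi|/IH[j [jr Pj xj]]]|[j [+ Pj xj]]].
- by exists i; rewrite mem_head.
- by exists j; rewrite inE jr orbT.
- rewrite inE => /predU1P[<-|jr]; [by left | by right; apply/IH; exists j].
Qed.

Theorem theorem2p10 (K : fieldType) (n m : nat) (G : sgraph n m)
    (G_connected : connected G) :
  subgraph_splittable K G <-> edge_splittable K G.
Proof.
split; last by case=> G1 [G2 [split12 _]]; exists G1, G2.
case=> G1 [G2 [_ _ split12 neq1 neq2]].
have idI := @is_ideal_toric K n m G.
have subI H (p : {mpoly K[m]}) : toric_ideal_sub G H p -> toric_ideal G p.
  exact: toric_ideal_subW.
pose lies_in (w : seq 'I_m) (H : subgr n m) := {subset w <= H.2}.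
have B_sub w (H : subgr n m) : even_closed_walk G w -> lies_in w H ->
    toric_ideal_sub G H (walk_binomial K w).
  move=> ww wH; apply: mem_ideal_gen; split.
    exact: walk_binomial_in_vars.
  exact: walk_binomial_toric.
pose good w := elementary_walk G w /\ (lies_in w G1 \/ lies_in w G2).
have [words words_all] := short_words 'I_m n.*2.
have [ws0 ws0P] := filter_prop good words.
have gen0 : generates (@walk_binomial K m) (toric_ideal G) ws0.
  move=> p; split.
    apply: ideal_gen_sub => // _ /mapP[w /ws0P[_ [[ww _ _] _]] ->].
    exact: walk_binomial_toric.
  set J := ideal_gen _; have idJ : is_ideal J := is_ideal_gen _.
  have JW w : good w -> J (walk_binomial K w).
    move=> good_w; apply: mem_ideal_gen; apply/map_f/ws0P; split=> //.
    by apply: words_all; case: good_w => [[]].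
  case/split12=> a [b [aI bI ->]]; case: (idJ) => _ JD _; apply: JD.
    by apply: toric_ideal_sub_elementary aI => // w ? ?; apply: JW; split; auto.
  by apply: toric_ideal_sub_elementary bI => // w ? ?; apply: JW; split; auto.
have [ws [ws_sub ws_uniq ws_min]] := minimal_generating_subsequence gen0.
have wsP w : w \in ws -> good w by move/ws_sub/ws0P => [].
have ws_gen J : is_ideal J -> (forall w, w \in ws -> J (walk_binomial K w)) ->
    forall p, toric_ideal G p -> J p.
  move=> idJ JW p; case: ws_min => gen_ws _; rewrite -gen_ws.
  by apply: ideal_gen_sub => // _ /mapP[w /JW Jw ->].
(* If all the generators came from [G2], then [I_G2] would be [I_G]. *)
have [w [w_ws [e [ew eG2]]]] :
    exists w, w \in ws /\ exists e, e \in w /\ e \notin G2.2.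
  apply: NNPP => none; apply: neq2 => p; split; first exact: subI.
  apply: ws_gen; first exact: is_ideal_gen.
  move=> w w_ws; have [[ww _ _] _] := wsP w w_ws; apply: B_sub => // e ew.
  by apply: NNPP => /negP eG2; apply: none; exists w; split=> //; exists e.
have in_edge_subgraph w' : w' \in ws -> e \in w' ->
    lies_in w' (edge_subgraph G ws e).
  move=> w'_ws ew' f fw'; apply/bigcup_seqP.
  by exists w'; rewrite !inE.
(* A generator whose walk uses [e] does not lie in [G2], hence lies in [G1]. *)
have edge_subgraph_G1 f : f \in (edge_subgraph G ws e).2 -> f \in G1.2.
  case/bigcup_seqP=> w' [/wsP[_ []] lies]; rewrite !inE.
    by move=> _ /lies.
  by move/lies; rewrite (negPf eG2).
exists (edge_subgraph G ws e), (del_edge n e); split; last first.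
  exists e, ws; split; last by left.
  by split=> // w' /wsP[[]].
split.
- move=> f /bigcup_seqP[w' [w'_ws ew' fw']]; apply/subsetP => x xf.
  apply/bigcup_seqP; exists w'; split=> //; apply/bigcupP; exists f => //.
  by move: fw'; rewrite inE.
- by move=> f _; apply: subsetT.
- move=> p; split; last first.
    by case=> a [b [/subI a0 /subI b0 ->]]; case: idI => _ D _; apply: D.
  apply: ws_gen.
    by apply: is_ideal_add; apply: is_ideal_gen.
  move=> w' w'_ws; have [[ww' _ _] _] := wsP w' w'_ws.
  have zero_in H := let: And3 z _ _ := @is_ideal_toric_sub K n m G H in z.
  have [ew'|ew'] := boolP (e \in w').
    exists (walk_binomial K w'), 0; rewrite addr0.
    by split=> //; apply: B_sub => //; apply: in_edge_subgraph.
  exists 0, (walk_binomial K w'); rewrite add0r; split=> //.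
  apply: B_sub => // f fw'; rewrite !inE; by apply: contraNneq ew' => <-.
- move=> eq1; apply: neq1 => p; split; first exact: subI.
  rewrite -(eq1 p); apply: ideal_gen_mono => q [qE q0]; split=> // u u_q f fG1.
  by apply: (qE u u_q); apply: contra fG1; apply: edge_subgraph_G1.
- move=> eq2; have [we _] := wsP w w_ws.
  apply: (elementary_not_del_edge we ew); apply/eq2.
  by case: we => ww _ _; apply: walk_binomial_toric.
Qed.
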